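(* Consider the rounded quantized VCG mechanism (defined in the context) with a given $\epsilon$, and set the monetary unit to $\delta=\frac{\epsilon}{M}$. Then for any agent $n$, it is an $\epsilon$-dominant strategy to report $\hat w_{nm}=\lfloor\frac{\hat v_{nm}}{\delta}\rfloor$ for the $m$-th partition. Moreover, if all agents play this $\epsilon$-dominant strategy, the maximum difference between the social welfare given by the quantized VCG mechanism and that given by the rounded quantized VCG mechanism is $\eta=\epsilon=M\delta$.
   Context: Setting: $\mathcal N=\{1,\dots,N\}$ is the set of agents. $f:2^{\mathcal N}\to\mathbb R$ is normalized ($f(\emptyset)=0$), monotone and submodular, with $f(\mathcal N)=1$ and strictly positive minimum distance $\triangle f=\min_{S\subseteq\mathcal N}\min_{i\ne j\in\mathcal N\setminus S}|f(S\cup\{i\})+f(S\cup\{j\})-f(S)-f(S\cup\{i,j\})|$. A divisible resource is to be allocated, with feasible allocations $\mathbf x\in\mathbb R_+^N$ satisfying $\sum_{n\in S}x_n\le f(S)$ for all $S\subseteq\mathcal N$. The resource is partitioned into $M$ equal divisions, where $M$ is an integer with $M\ge 2/\triangle f$. Let $\tilde f(S)=\lfloor f(S)M\rfloor$ and $P_{\tilde f}=\{\mathbf y\in\mathbb N^N:\sum_{n\in S}y_n\le\tilde f(S)\ \forall S\subseteq\mathcal N\}$, which is an integral polymatroid; $y_n$ is the number of divisions given to agent $n$. Each agent $n$ has a private utility function $u_n$ of her allocation that is nonnegative, concave and strictly increasing with $\beta<u_n'<\alpha$, where $\alpha,\beta>0$ are publicly known constants. The true surrogate marginal utilities are $\hat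 v_{nm}=u_n(\frac mM)-u_n(\frac{m-1}M)-\frac\beta M$, $1\le m\le\tilde f(\{n\})$. Quantized VCG mechanism: each agent $n$ submits a surrogate marginal utility vector $\hat V_n=(\hat v_{n1},\dots,\hat v_{n\tilde f(\{n\})})$. The allocation $\mathbf y^*\in P_{\tilde f}$ maximizes $\sum_n\left(\sum_{m=1}^{y_n}\hat v_{nm}+\frac{\beta y_n}{M}\right)$ over $\mathbf y\in P_{\tilde f}$, and $\mathrm{OPT}(\hat V)=\sum_n\sum_{m=1}^{y_n^*}\hat v_{nm}$. Agent $n$ receives $y_n^*/M$ and pays $p_n=\mathrm{OPT}(0,\hat V_{-n})-\left(\mathrm{OPT}(\hat V)-\sum_{m=1}^{y_n^*}\hat v_{nm}\right)+\frac{y_n^*\beta}{M}$, where $(0,\hat V_{-n})$ is $\hat V$ with agent $n$'s vector replaced by zero. Truthful reporting is a weakly dominant strategy, and the social welfare given by this mechanism is that under truthful reports, namely $\max_{\mathbf y\in P_{\tilde f}}\sum_n u_n(y_n/M)$. Rounded quantized VCG mechanism with monetary unit $\delta$: each agent $n$ submits a non-increasing integer vector $\hat W_n=(\hat w_{n1},\dots,\hat w_{n\tilde f(\{n\})})$, and the quantized VCG mechanism (allocation and payments) is run with the vectors $\hat V_n=\hat W_n\delta$, ties being broken randomly. If $\tilde{\mathbf y}^*$ is the resulting allocation of divisions, the social welfare given by this mechanism is $\sum_n u_n(\tilde y_n^*/M)$, evaluated with the true utilities. Agent $n$'s payoff is $u_n(\tilde y_n^*/M)-p_n$. For $\epsilon\ge0$,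 a strategy $\sigma_n^*$ of agent $n$ is $\epsilon$-dominant if for all strategies $\sigma_n$ of agent $n$ and all strategies $\sigma_{-n}$ of the other agents, agent $n$'s payoff under $(\sigma_n,\sigma_{-n})$ exceeds her payoff under $(\sigma_n^*,\sigma_{-n})$ by at most $\epsilon$.
   Formalization: Among tied optimal allocations, one giving out the most divisions is chosen (this matters only if a reported marginal equals −β/M, where OPT is otherwise ill-defined and ε-dominance can fail); ε>0 is assumed; the ''maximum difference'' is a bound and a supremum over environments, as it is not attained. *)

(* Defs.v *)
From HB Require Import structures.
From mathcomp Require Import all_boot all_order all_algebra.
From mathcomp Require Import all_classical all_reals all_analysis.

Set Implicit Arguments.
Unset Strict Implicit.
Unset Printing Implicit Defensive.

Import Order.TTheory GRing.Theory Num.Theory.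
Import numFieldNormedType.Exports.
Local Open Scope classical_set_scope.
Local Open Scope ring_scope.

(* Agents are the elements of 'I_N.  Marginals are numbered from 0: entry m of
   a report is the marginal of the (m+1)-st division. *)

Section Resource.
Variables (R : realType) (N : nat) (f : {set 'I_N} -> R).

Definition normalized := f finset.set0 = 0.

Definition monotone_setfun :=
  forall S T : {set 'I_N}, S \subset T -> f S <= f T.

Definition submodular :=
  forall S T : {set 'I_N}, f (S :|: T) + f (S :&: T) <= f S + f T.

(* The infimum of a finite set, hence a minimum, as soon as 2 <= N.  For N < 2
   there is no pair of agents and the value is inf set0 = 0. *)
Definition min_distance : R :=
  inf [set d | exists (S : {set 'I_N}) (i j : 'I_N),
        [/\ i \notin S, j \notin S, i != j &
            d = `|f (i |: S) + f (j |: S) - f S - f (i |: (j |: S))|]].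

End Resource.

(* Differentiability is asked for on ]0, +oo[, with right continuity at 0; a
   one-sided derivative at 0 is not required. *)
Definition utility (R : realType) (alpha beta : R) (u : R -> R) : Prop :=
  [/\ forall x, 0 <= x -> 0 <= u x,
      convex_function (`[0, +oo[ : set R^o) (fun x => - u x),
      {in `[0, +oo[ &, {homo u : x y / x < y}},
      derivable_oy_Rcontinuous u 0
    & forall x, 0 < x -> beta < derive1 u x < alpha].

Section Mechanism.
Variables (R : realType) (N : nat) (f : {set 'I_N} -> R) (M : nat) (beta : R).

Definition allocation := {ffun 'I_N -> nat}.

Definition reports := {ffun 'I_N -> seq R}.

(* truncn is the floor, as a natural number, of a nonnegative real *)
Definition ftilde (S : {set 'I_N}) : nat := Num.truncn (f S * M%:R).

Definition feasible (y : allocation) : Prop :=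
  forall S : {set 'I_N}, (\sum_(n in S) y n <= ftilde S)%N.

Definition reported_value (V : reports) (y : allocation) (n : 'I_N) : R :=
  \sum_(0 <= m < y n) (V n)`_m.

Definition objective (V : reports) (y : allocation) : R :=
  \sum_n (reported_value V y n + beta * (y n)%:R / M%:R).

Definition optimal (V : reports) (y : allocation) : Prop :=
  feasible y /\ forall z, feasible z -> objective V z <= objective V y.

(* A realization of the tie-breaking: random tie-breaking is a probability law
   on such rules.  The second clause only matters when some reported marginal
   is exactly - beta / M: if all of them are > - beta / M, in particular if
   they are nonnegative, every optimal allocation hands out ftilde setT
   divisions.  It makes OPT below independent of the optimal allocation used
   to compute it; if a division of reported surplus - beta / M could be handed
   out or not at will, OPT V would not be a function of V. *)
Definition tie_breaking (tie : reports -> allocation) : Prop :=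
  forall V, optimal V (tie V) /\
    forall z, optimal V z -> (\sum_n z n <= \sum_n tie V n)%N.

Definition replace_report (T : Type) (V : {ffun 'I_N -> T}) (n : 'I_N) (s : T)
    : {ffun 'I_N -> T} :=
  [ffun k => if k == n then s else V k].

Definition zero_report (V : reports) (n : 'I_N) : reports :=
  replace_report V n (nseq (ftilde [set n]%SET) 0).

Variable tie : reports -> allocation.

Definition OPT (V : reports) : R := \sum_n reported_value V (tie V) n.

Definition payment (V : reports) (n : 'I_N) : R :=
  OPT (zero_report V n) - (OPT V - reported_value V (tie V) n)
  + (tie V n)%:R * beta / M%:R.

Variable u : 'I_N -> R -> R.

Definition payoff (V : reports) (n : 'I_N) : R :=
  u n ((tie V n)%:R / M%:R) - payment V n.

Definition social_welfare (y : allocation) : R :=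
  \sum_n u n ((y n)%:R / M%:R).

Definition true_marginal (n : 'I_N) (m : nat) : R :=
  u n (m.+1%:R / M%:R) - u n (m%:R / M%:R) - beta / M%:R.

Definition truthful : reports :=
  [ffun n => mkseq (true_marginal n) (ftilde [set n]%SET)].

Definition quantized_welfare : R := social_welfare (tie truthful).

Variable delta : R.

Definition strategy (n : 'I_N) (w : seq int) : Prop :=
  size w = ftilde [set n]%SET /\ sorted >=%R w.

Definition scaled (W : {ffun 'I_N -> seq int}) : reports :=
  [ffun n => [seq w%:~R * delta | w <- W n]].

Definition rounded_payoff (W : {ffun 'I_N -> seq int}) (n : 'I_N) : R :=
  payoff (scaled W) n.

Definition rounded_report (n : 'I_N) : seq int :=
  mkseq (fun m => Num.floor (true_marginal n m / delta)) (ftilde [set n]%SET).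

Definition rounded_welfare : R :=
  social_welfare (tie (scaled [ffun n => rounded_report n])).

End Mechanism.

(* The profile W carries both the deviation W n and the strategies of the
   other agents. *)
Definition eps_dominant (R : realType) (N : nat) (T : Type)
    (strat : 'I_N -> T -> Prop) (pay : {ffun 'I_N -> T} -> 'I_N -> R)
    (eps : R) (n : 'I_N) (s : T) : Prop :=
  strat n s /\
  forall W : {ffun 'I_N -> T}, (forall k, strat k (W k)) ->
    pay W n <= pay (replace_report W n s) n + eps.

Record environment (R : realType) (N : nat) (f : {set 'I_N} -> R) (M : nat)
    (alpha beta : R) (u : 'I_N -> R -> R)
    (tie : reports R N -> allocation N) : Prop := Environment {
  env_normalized : normalized f;
  env_monotone : monotone_setfun f;
  env_submodular : submodular f;
  env_total : f [set: 'I_N]%SET = 1;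
  env_min_distance : 0 < min_distance f;
  env_divisions : 2 / min_distance f <= M%:R;
  env_alpha : 0 < alpha;
  env_beta : 0 < beta;
  env_utility : forall n, utility alpha beta (u n);
  env_tie : tie_breaking f M beta tie }.

Definition welfare_gap (R : realType) (N : nat) (f : {set 'I_N} -> R) (M : nat)
    (beta : R) (u : 'I_N -> R -> R) (tie : reports R N -> allocation N)
    (delta : R) : R :=
  `|quantized_welfare f M beta tie u - rounded_welfare f M beta tie u delta|.

Definition welfare_gaps (R : realType) (M : nat) (delta : R) : set R :=
  [set g | exists N (f : {set 'I_N} -> R) (alpha beta : R)
             (u : 'I_N -> R -> R) (tie : reports R N -> allocation N),
      environment f M alpha beta u tie /\
      g = welfare_gap f M beta u tie delta].

(* Main.v *)
(* Rounding down changes the value of every division by an amount in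
   [0, delta], so it changes the objective of a feasible allocation, which hands
   out at most M divisions, by an amount in [0, M * delta]; this bounds the
   welfare gap.  An agent's payoff is, up to a term that she does not influence,
   the total value of the allocation when her own report is replaced by the
   truth.  This differs from the maximized objective by beta / M times the number
   of divisions handed out, which may depend on her report when some reported
   values lie below - beta / M.  Because ftilde is an integral polymatroid rank
   function, an allocation obtained by deviating can be extended, by giving her
   alone further divisions of nonnegative value, until it hands out at least as
   many divisions as the allocation under the rounded report.  That the bound on
   the welfare gap is sharp is seen with two agents whose utilities are linear,
   with marginals almost 2 * delta and exactly delta. *)

Require Import Defs.
From HB Require Import structures.
From mathcomp Require Import all_boot all_order all_algebra.
From mathcomp Require Import all_classical all_reals all_analysis.
From mathcomp Require Import ring lra.
Import Order.TTheory GRing.Theory Num.Theory.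
Import numFieldNormedType.Exports.
Local Open Scope ring_scope.

Set Implicit Arguments.
Unset Strict Implicit.

(** * Utilities and true marginals *)

(** Mean value theorem on [[a, b]]; right continuity at 0 covers the case [a = 0], where no
    derivative is assumed. *)
Lemma utility_increment_gt (R : realType) (alpha beta : R) (u : R -> R)
    (a b : R) :
  utility alpha beta u -> 0 <= a -> a < b -> beta * (b - a) < u b - u a.
Proof.
case=> _ _ _ dcu bnd a0 ab.
have [du lu ru] := derivable_oy_continuousWoo ab a0 dcu.
have uab : {within `[a, b], continuous u}%classic.
  apply/(continuous_within_itvP _ ab); split=> // x xab.
  by apply: differentiable_continuous; apply/derivable1_diffP; exact: du.
have dud x : x \in `]a, b[ -> is_derive x 1 u (derive1 u x).
  by move=> xab; rewrite derive1E; apply: DeriveDef => //; exact: du.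
have [c cab ->] := MVT ab dud uab.
move: cab; rewrite in_itv/= => /andP[ac _].
rewrite ltr_pM2r ?subr_gt0//.
by have /andP[] := bnd c (le_lt_trans a0 ac).
Qed.

Lemma utility_midpoint (R : realType) (alpha beta : R) (u : R -> R) (a b : R) :
  utility alpha beta u -> 0 <= a -> 0 <= b ->
  u a + u b <= 2 * u ((a + b) / 2).
Proof.
case=> _ cvx _ _ _ a0 b0.
have half0 : 0 <= 2^-1 :> R by lra.
have half1 : 2^-1 <= 1 :> R by lra.
pose t : {i01 R} := Itv01 half0 half1.
have memp x : 0 <= x -> x \in (`[0, +oo[%classic : set R).
  by move=> x0; rewrite inE/= in_itv/= x0.
have : - u (2^-1 * a + (1 - 2^-1) * b) <= 2^-1 * - u a + (1 - 2^-1) * - u b.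
  exact: cvx t a b (memp a a0) (memp b b0).
have -> : 2^-1 * a + (1 - 2^-1) * b = (a + b) / 2 :> R by field.
by lra.
Qed.

Lemma true_marginal_gt0 (R : realType) (N M : nat) (alpha beta : R)
    (u : 'I_N -> R -> R) (n : 'I_N) (m : nat) :
  (0 < M)%N -> utility alpha beta (u n) -> 0 < true_marginal M beta u n m.
Proof.
move=> M0 un; have M0' : 0 < M%:R :> R by rewrite ltr0n.
have lt_frac : m%:R / M%:R < m.+1%:R / M%:R :> R.
  by rewrite ltr_pM2r ?invr_gt0// ltr_nat.
have := utility_increment_gt un _ lt_frac.
rewrite divr_ge0// => /(_ isT); rewrite /true_marginal subr_gt0.
suff -> : beta * (m.+1%:R / M%:R - m%:R / M%:R) = beta / M%:R :> R by [].
by rewrite -natr1; field; rewrite gt_eqF.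
Qed.

(** Midpoint concavity at the equidistant points m/M, (m+1)/M, (m+2)/M compares consecutive
    marginals. *)
Lemma true_marginal_noninc (R : realType) (N M : nat) (alpha beta : R)
    (u : 'I_N -> R -> R) (n : 'I_N) :
  utility alpha beta (u n) ->
  {homo true_marginal M beta u n : i j / (i <= j)%N >-> j <= i}.
Proof.
move=> un; apply: homo_leq => [//|x y z /[swap]|m]; first exact: le_trans.
have := @utility_midpoint R alpha beta _ (m%:R / M%:R) (m.+2%:R / M%:R) un.
rewrite !divr_ge0// => /(_ isT isT).
have -> : (m%:R / M%:R + m.+2%:R / M%:R) / 2 = m.+1%:R / M%:R :> R.
  by rewrite -[m.+2]addn2 -[m.+1]addn1 !natrD -mulrDl mulrAC; congr (_ / _);
     field.
by rewrite /true_marginal; lra.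
Qed.

(** * Submodularity sharpened by the minimum distance *)

Lemma min_distance_le (R : realType) (N : nat) (f : {set 'I_N} -> R)
    (S : {set 'I_N}) (i j : 'I_N) :
  i \notin S -> j \notin S -> i != j ->
  min_distance f <= `|f (i |: S) + f (j |: S) - f S - f (i |: (j |: S))|.
Proof.
move=> iS jS ij; apply: ge_inf; last by exists S, i, j.
by exists 0 => _ [S' [i' [j' [_ _ _ ->]]]].
Qed.

(** Take i in A but not B, j in B but not A, and I the intersection. The minimum distance gives the
    gain for I+i and I+j; submodularity for A and I+i+j, then for B and A+j, carries it over to A
    and B. *)
Lemma submodular_crossing (R : realType) (N : nat) (f : {set 'I_N} -> R)
    (A B : {set 'I_N}) :
  submodular f -> ~~ (A \subset B) -> ~~ (B \subset A) ->
  f (A :|: B) + f (A :&: B) + min_distance f <= f A + f B.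
Proof.
move=> subf /subsetPn[i iA iB] /subsetPn[j jB jA].
set I := A :&: B.
have iI : i \notin I by rewrite inE (negbTE iB) andbF.
have jI : j \notin I by rewrite inE (negbTE jA).
have ij : i != j by apply: contraNneq iB => ->.
have := min_distance_le f iI jI ij.
have UI : (i |: I) :|: (j |: I) = i |: (j |: I).
  by rewrite finset.setUACA finset.setUid -finset.setUA.
have II : (i |: I) :&: (j |: I) = I.
  apply/finset.setP => k; rewrite !inE.
  have [->|] := eqVneq k i; first by rewrite (negbTE ij) (negbTE iB) !andbF.
  by rewrite /= => _; case: (k \in A); case: (k \in B); rewrite ?andbF ?orbT.
have := subf (i |: I) (j |: I); rewrite UI II => loc.
rewrite ger0_norm; last by lra.
have := subf A (i |: (j |: I)).
have -> : A :|: (i |: (j |: I)) = j |: A.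
  apply/finset.setP => k; rewrite !inE.
  have [->|_] := eqVneq k i; first by rewrite iA orbT.
  by case: (k \in A); rewrite ?orbT ?orbF//= .
have -> : A :&: (i |: (j |: I)) = i |: I.
  apply/finset.setP => k; rewrite !inE.
  have [->|_] := eqVneq k i; first by rewrite iA.
  have [->|_] := eqVneq k j; first by rewrite (negbTE jA).
  by case: (k \in A).
have := subf B (j |: A).
have -> : B :|: (j |: A) = A :|: B.
  apply/finset.setP => k; rewrite !inE.
  have [->|_] := eqVneq k j; first by rewrite jB orbT.
  by rewrite orbC.
have -> : B :&: (j |: A) = j |: I.
  apply/finset.setP => k; rewrite !inE.
  have [->|_] := eqVneq k j; first by rewrite jB.
  by rewrite andbC.
by lra.
Qed.

Lemma min_distance_le1 (R : realType) (N : nat) (f : {set 'I_N} -> R) :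
  normalized f -> monotone_setfun f -> submodular f ->
  f [set: 'I_N]%SET = 1 -> 0 < min_distance f -> min_distance f <= 1.
Proof.
move=> f0 mono subf f1 pos.
have [[S [i [j [iS jS ij]]]]|no_pair] := pselect (exists (S : {set 'I_N}) i j,
    [/\ i \notin S, j \notin S & i != j]); last first.
  (* Without two distinct agents the infimum is taken over the empty set, hence is 0 by convention,
     against positivity. *)
  move: pos; rewrite /min_distance.
  rewrite (_ : [set d | _]%classic = classical_sets.set0) ?inf0 ?ltxx//.
  apply/seteqP; split=> // d [S [i [j [? ? ? _]]]].
  by apply: no_pair; exists S, i, j.
apply: le_trans (min_distance_le f iS jS ij) _.
have iSij : f (i |: S) <= f (i |: (j |: S)).
  by apply: mono; exact: finset.setUS (finset.subsetU1 _ _).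
have jST : f (j |: S) <= 1 by rewrite -f1; apply: mono; exact: finset.subsetT.
have S0 : 0 <= f S by rewrite -f0; apply: mono; exact: finset.sub0set.
have := subf (i |: S) (j |: S).
have -> : (i |: S) :|: (j |: S) = i |: (j |: S).
  by rewrite finset.setUACA finset.setUid -finset.setUA.
have -> : (i |: S) :&: (j |: S) = S.
  apply/finset.setP => k; rewrite !inE.
  have [->|] := eqVneq k i; first by rewrite (negbTE ij) (negbTE iS).
  by rewrite /= => _; case: (k \in S); rewrite ?andbF ?orbT.
by move=> sub; rewrite ger0_norm; lra.
Qed.

(** * Tight sets and added divisions *)

(** Uncrossing: sums of [y] are modular and those of [g] submodular, so slack on the union would
    have to be offset by a violated bound on the intersection. *)
Lemma tight_setU (T : finType) (g : {set T} -> nat) (y : T -> nat)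
    (A B : {set T}) :
  (forall A B, g (A :|: B) + g (A :&: B) <= g A + g B)%N ->
  (forall S : {set T}, \sum_(n in S) y n <= g S)%N ->
  \sum_(n in A) y n = g A -> \sum_(n in B) y n = g B ->
  \sum_(n in A :|: B) y n = g (A :|: B).
Proof.
move=> subg yg yA yB; apply/eqP; rewrite eqn_leq yg/=.
have sumUI : (\sum_(n in A :|: B) y n + \sum_(n in A :&: B) y n =
              \sum_(n in A) y n + \sum_(n in B) y n)%N.
  rewrite (big_setID B (A := A :|: B))/= finset.setUC finset.setUK.
  rewrite finset.setDUl finset.setDv finset.set0U.
  by rewrite (big_setID B (A := A))/=; ring.
rewrite -(leq_add2r (\sum_(n in A :&: B) y n)) sumUI yA yB.
by apply: leq_trans (subg A B); rewrite leq_add2l yg.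
Qed.

(* The union U of all tight sets is tight, so y' is not larger than y on U, and
   by assumption it is not larger outside of U either. *)
Lemma saturated_sum_le (T : finType) (g : {set T} -> nat) (y y' : T -> nat) :
  g finset.set0 = 0%N ->
  (forall A B, g (A :|: B) + g (A :&: B) <= g A + g B)%N ->
  (forall S : {set T}, \sum_(n in S) y n <= g S)%N ->
  (forall S : {set T}, \sum_(n in S) y' n <= g S)%N ->
  (forall k, (y k < y' k)%N ->
     exists2 S : {set T}, k \in S & \sum_(n in S) y n = g S) ->
  (\sum_n y' n <= \sum_n y n)%N.
Proof.
move=> g0 subg yg y'g sat.
pose tight := [pred S : {set T} | \sum_(n in S) y n == g S].
have tight0 : tight finset.set0 by rewrite /= big_set0 g0.
(* A tight set of largest cardinality contains every tight set, as its union with another one is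
   again tight. *)
case: (arg_maxnP (fun S : {set T} => #|S|) tight0) => U /eqP tightU maxU.
have sub_U (S : {set T}) : \sum_(n in S) y n = g S -> S \subset U.
  move=> tightS; have tightUS := tight_setU subg yg tightU tightS.
  have /eqP -> : U == U :|: S.
    rewrite eqEcard finset.subsetUl; apply: maxU.
    by rewrite /= tightUS.
  exact: finset.subsetUr.
rewrite (bigID (mem U))/= [leqRHS](bigID (mem U))/= leq_add//.
  by rewrite tightU y'g.
apply: leq_sum => k kU; rewrite leqNgt; apply: contra kU => /sat[S kS tightS].
exact: (fintype.subsetP (sub_U _ tightS)).
Qed.

Definition add_units (N : nat) (y : allocation N) (n : 'I_N) (t : nat) :
  allocation N := [ffun j => y j + (j == n) * t]%N.

Lemma sum_add_units (N : nat) (y : allocation N) (n : 'I_N) (t : nat)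
    (S : {set 'I_N}) :
  \sum_(j in S) add_units y n t j = (\sum_(j in S) y j + (n \in S) * t)%N.
Proof.
rewrite (eq_bigr _ (fun j _ => ffunE _ j)) big_split/=; congr addn.
have [nS|nS] := boolP (n \in S).
  rewrite (bigD1 n)//= eqxx big1 ?addr0// => j /andP[_ /negbTE->].
  by rewrite mul0n.
rewrite big1// => j jS; have [jn|] := eqVneq j n; last by rewrite mul0n.
by rewrite -jn jS in nS.
Qed.

(** * The integral polymatroid given by [ftilde] *)

Lemma ftilde_le (R : realType) (N : nat) (f : {set 'I_N} -> R) (M : nat)
    (S : {set 'I_N}) :
  monotone_setfun f -> f [set: 'I_N]%SET = 1 -> (ftilde f M S <= M)%N.
Proof.
move=> mono f1; rewrite truncn_le_nat; apply: (@le_lt_trans _ _ M%:R).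
  by rewrite ler_piMl// -f1; apply: mono; exact: finset.subsetT.
by rewrite ltr_nat.
Qed.

Lemma ftilde0 (R : realType) (N : nat) (f : {set 'I_N} -> R) (M : nat) :
  normalized f -> ftilde f M finset.set0 = 0%N.
Proof. by move=> f0; rewrite /ftilde f0 mul0r truncn0. Qed.

(* M min_distance >= 2 absorbs the two roundings on the larger side. *)
Lemma ftilde_submodular (R : realType) (N : nat) (f : {set 'I_N} -> R)
    (M : nat) (A B : {set 'I_N}) :
  normalized f -> monotone_setfun f -> submodular f ->
  0 < min_distance f -> 2 / min_distance f <= M%:R ->
  (ftilde f M (A :|: B) + ftilde f M (A :&: B) <=
   ftilde f M A + ftilde f M B)%N.
Proof.
move=> f0 mono subf d0; rewrite ler_pdivrMr// => Md.
have [AB|AB] := boolP (A \subset B).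
  by rewrite (finset.setUidPr AB) (finset.setIidPl AB) addnC.
have [BA|BA] := boolP (B \subset A).
  by rewrite (finset.setUidPl BA) (finset.setIidPr BA).
have /(ler_wpM2r (ler0n R M)) := submodular_crossing subf AB BA.
rewrite -ltnS -(ltr_nat R) !mulrDl.
have fM0 S : 0 <= f S * M%:R.
  by rewrite mulr_ge0// -f0; apply: mono; exact: finset.sub0set.
have /andP[] := truncn_itv (fM0 (A :|: B)).
have /andP[] := truncn_itv (fM0 (A :&: B)).
have /andP[] := truncn_itv (fM0 A); have /andP[] := truncn_itv (fM0 B).
by rewrite /ftilde -!natr1 !natrD; lra.
Qed.

Lemma feasible_le (R : realType) (N : nat) (f : {set 'I_N} -> R) (M : nat)
    (y : allocation N) (n : 'I_N) :
  feasible f M y -> (y n <= ftilde f M [set n]%SET)%N.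
Proof. by move/(_ [set n]%SET); rewrite big_set1. Qed.

Lemma feasible_sum_le (R : realType) (N : nat) (f : {set 'I_N} -> R) (M : nat)
    (y : allocation N) :
  monotone_setfun f -> f [set: 'I_N]%SET = 1 -> feasible f M y ->
  (\sum_n y n <= M)%N.
Proof.
move=> mono f1 yf; rewrite (eq_bigl (mem [set: 'I_N]%SET)).
  exact: leq_trans (yf _) (ftilde_le _ _ mono f1).
by move=> n; rewrite /= inE.
Qed.

Lemma feasible_antimono (R : realType) (N : nat) (f : {set 'I_N} -> R)
    (M : nat) (y z : allocation N) :
  (forall n, y n <= z n)%N -> feasible f M z -> feasible f M y.
Proof. by move=> yz zf S; apply: leq_trans (zf S); apply: leq_sum. Qed.

(** One more division for [k] only affects the constraints of sets containing [k], so one of these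
    must already be an equality. *)
Lemma saturated_tight (R : realType) (N : nat) (f : {set 'I_N} -> R) (M : nat)
    (y : allocation N) (k : 'I_N) :
  feasible f M y -> ~ feasible f M (add_units y k 1) ->
  exists2 S : {set 'I_N}, k \in S & \sum_(n in S) y n = ftilde f M S.
Proof.
move=> yf nf; apply: contrapT => notight; apply: nf => S.
rewrite sum_add_units muln1; have [kS|_] := boolP (k \in S); last first.
  by rewrite addn0 yf.
rewrite addn1 ltn_neqAle yf andbT; apply/eqP => tightS.
by apply: notight; exists S.
Qed.

(** Otherwise every [t] would be feasible, by induction, against the constraint of the singleton of
    [n]. *)
Lemma exists_saturation (R : realType) (N : nat) (f : {set 'I_N} -> R)
    (M : nat) (y : allocation N) (n : 'I_N) :
  feasible f M y ->
  exists t, feasible f M (add_units y n t) /\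
    ~ feasible f M (add_units (add_units y n t) n 1).
Proof.
move=> yf; apply: contrapT => unbounded.
have all_feasible t : feasible f M (add_units y n t).
  elim: t => [|t IH].
    by apply: feasible_antimono yf => j; rewrite ffunE muln0 addn0.
  apply: contrapT => nf; apply: unbounded; exists t; split=> // tf; apply: nf.
  by apply: feasible_antimono tf => j; rewrite !ffunE -addnA -mulnDr addn1.
have := feasible_le n (all_feasible (ftilde f M [set n]%SET).+1).
by rewrite ffunE eqxx mul1n addnS ltnNge leq_addl.
Qed.

(** * Objective, welfare and payoff as functions of the allocation *)

(** The quantity that [OPT] computes, but at an arbitrary allocation, so that one allocation can be
    valued under several reports. *)
Definition total_value (R : realType) (N : nat) (V : reports R N)
  (y : allocation N) : R := \sum_n reported_value V y n.

Lemma objectiveE (R : realType) (N M : nat) (beta : R) (V : reports R N)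
    (y : allocation N) :
  objective M beta V y = total_value V y + beta / M%:R * (\sum_n y n)%:R.
Proof.
rewrite /objective big_split/= natr_sum mulr_sumr; congr (_ + _).
by apply: eq_bigr => n _; rewrite mulrAC.
Qed.

(** Marginals are numbered from 0, so the next division of [k] has index [y k]. *)
Lemma objective_add_unit (R : realType) (N M : nat) (beta : R)
    (V : reports R N) (y : allocation N) (k : 'I_N) :
  objective M beta V (add_units y k 1) =
  objective M beta V y + ((V k)`_(y k) + beta / M%:R).
Proof.
rewrite /objective (bigD1 k)//= [in RHS](bigD1 k)//=.
have -> : add_units y k 1 k = (y k).+1 by rewrite ffunE eqxx addn1.
rewrite /reported_value ffunE eqxx muln1 addn1 big_nat_recr//= -natr1.
rewrite (eq_bigr (fun i => \sum_(0 <= m < y i) (V i)`_m +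
  beta * (y i)%:R / M%:R)); first by ring.
by move=> i /negbTE ik; rewrite ffunE ik addn0.
Qed.

Lemma total_value_add_units (R : realType) (N : nat) (V : reports R N)
    (y : allocation N) (n : 'I_N) (t : nat) :
  (forall m, (m < y n + t)%N -> 0 <= (V n)`_m) ->
  total_value V y <= total_value V (add_units y n t).
Proof.
move=> V0; apply: ler_sum => j _; rewrite /reported_value ffunE.
have [->|_] := eqVneq j n; last by rewrite addn0.
rewrite mul1n [leRHS](@big_cat_nat _ _ _ (y n))//= ?leq_addr//.
rewrite lerDl big_nat_cond sumr_ge0// => m.
by rewrite andbT => /andP[_]; exact: V0.
Qed.

Lemma objective_perturbation (R : realType) (N : nat) (f : {set 'I_N} -> R)
    (M : nat) (beta delta : R) (V V' : reports R N) (y : allocation N) :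
  monotone_setfun f -> f [set: 'I_N]%SET = 1 -> feasible f M y ->
  (forall n m, (m < ftilde f M [set n]%SET)%N ->
     (V' n)`_m <= (V n)`_m <= (V' n)`_m + delta) -> 0 <= delta ->
  objective M beta V' y <= objective M beta V y <=
  objective M beta V' y + M%:R * delta.
Proof.
move=> mono f1 yf VV' d0; rewrite !objectiveE lerD2r addrAC lerD2r.
apply/andP; split.
  apply: ler_sum => n _; apply: ler_sum_nat => m /andP[_ my].
  by have /andP[] := VV' n m (leq_trans my (feasible_le n yf)).
(* An error of at most [delta] for each division handed out, of which there are at most [M]. *)
apply: (@le_trans _ _ (total_value V' y + (\sum_n y n)%:R * delta)); last first.
  by rewrite lerD2l ler_wpM2r// ler_nat (feasible_sum_le mono f1 yf).
rewrite natr_sum mulr_suml -big_split/=; apply: ler_sum => n _.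
rewrite /reported_value mulr_natl -[y n in leRHS]subn0 -sumr_const_nat subn0.
rewrite -big_split/=; apply: ler_sum_nat => m /andP[_ my].
by have /andP[] := VV' n m (leq_trans my (feasible_le n yf)).
Qed.

(** The marginals telescope; feasibility keeps [y n] within the length of the report, so that no
    default value is read. *)
Lemma reported_truthful (R : realType) (N : nat) (f : {set 'I_N} -> R)
    (M : nat) (beta : R) (u : 'I_N -> R -> R) (y : allocation N) (n : 'I_N) :
  feasible f M y ->
  reported_value (truthful f M beta u) y n =
  u n ((y n)%:R / M%:R) - u n 0 - (y n)%:R * beta / M%:R.
Proof.
move=> yf; rewrite /reported_value ffunE.
rewrite (eq_big_nat _ _ (F2 := true_marginal M beta u n)); last first.
  by move=> m /andP[_ my]; rewrite nth_mkseq// (leq_trans my (feasible_le n yf)).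
rewrite /true_marginal sumrB (telescope_sumr (fun m => u n (m%:R / M%:R)))//.
by rewrite sumr_const_nat subn0 mul0r -[beta / _ *+ _]mulr_natl mulrA.
Qed.

(** Up to a constant, the objective under truthful reports is the welfare, so welfare gaps become
    gaps of objectives. *)
Lemma social_welfareE (R : realType) (N : nat) (f : {set 'I_N} -> R) (M : nat)
    (beta : R) (u : 'I_N -> R -> R) (y : allocation N) :
  feasible f M y ->
  social_welfare M u y =
  \sum_n u n 0 + objective M beta (truthful f M beta u) y.
Proof.
move=> yf; rewrite /objective -big_split/=; apply: eq_bigr => n _.
by rewrite (reported_truthful _ _ _ yf); ring.
Qed.

(** The VCG identity: the first two terms do not depend on the report of [n], which matters only
    through the allocation [tie V]. *)
Lemma payoffE (R : realType) (N : nat) (f : {set 'I_N} -> R) (M : nat)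
    (beta : R) (u : 'I_N -> R -> R) (tie : reports R N -> allocation N)
    (V : reports R N) (n : 'I_N) :
  feasible f M (tie V) ->
  payoff f M beta tie u V n =
  u n 0 - OPT tie (zero_report f M V n) +
  total_value (replace_report V n (truthful f M beta u n)) (tie V).
Proof.
move=> yf; set T := truthful f M beta u; rewrite /payoff /payment.
set Z := OPT tie (zero_report _ _ _ _).
have own : reported_value (replace_report V n (T n)) (tie V) n =
           reported_value T (tie V) n.
  by rewrite /reported_value ffunE eqxx.
rewrite /OPT /total_value (bigD1 n)//= [in RHS](bigD1 n)//= own.
rewrite (reported_truthful _ _ _ yf).
rewrite [in RHS](eq_bigr (reported_value V (tie V))); first by ring.
by move=> k /negbTE kn; rewrite /reported_value ffunE kn.
Qed.

(** * Comparing a deviation with the rounded report *)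

(* If agent k could still receive a division under y, then her next reported
   marginal, hence any later one, would be below - beta / M, and y' would improve
   by taking a division back from her. *)
Lemma tie_not_extendable (R : realType) (N : nat) (f : {set 'I_N} -> R)
    (M : nat) (beta : R) (V V' : reports R N) (y y' : allocation N) (k : 'I_N) :
  optimal f M beta V y ->
  (forall z, optimal f M beta V z -> (\sum_n z n <= \sum_n y n)%N) ->
  optimal f M beta V' y' -> V' k = V k ->
  (forall i j, (i <= j < ftilde f M [set k]%SET)%N -> (V k)`_j <= (V k)`_i) ->
  (y k < y' k)%N -> ~ feasible f M (add_units y k 1).
Proof.
move=> [yf yopt] ymax [y'f y'opt] VV' Vmono yk extf.
(* Otherwise the extended allocation would be optimal too and hand out more divisions, against the
   choice of [y]. *)
have neg : (V k)`_(y k) + beta / M%:R < 0.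
  rewrite ltNge; apply/negP => ge0.
  have : optimal f M beta V (add_units y k 1).
    split=> // z zf; apply: le_trans (yopt z zf) _.
    by rewrite objective_add_unit lerDl.
  move/ymax; rewrite leqNgt => /negP; apply.
  have sumT (x : allocation N) : (\sum_n x n = \sum_(n in [set: 'I_N]%SET) x n)%N.
    by apply: eq_bigl => n; rewrite inE.
  by rewrite !sumT sum_add_units inE mul1n addn1.
pose z : allocation N := [ffun j => y' j - (j == k)]%N.
have zy' : add_units z k 1 = y'.
  apply/ffunP => j; rewrite !ffunE; have [->|_] := eqVneq j k.
    by rewrite subnK// (leq_ltn_trans _ yk).
  by rewrite subn0 addn0.
have zf : feasible f M z.
  by apply: feasible_antimono y'f => j; rewrite ffunE leq_subr.
have := y'opt z zf; rewrite -{1}zy' objective_add_unit lerDl leNgt => /negP.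
(* The division taken back has index [y' k - 1], which is at least [y k], so its marginal is no
   larger than the one in [neg]. *)
apply; apply: le_lt_trans neg; rewrite lerD2r VV'; apply: Vmono.
rewrite ffunE eqxx subn1 -ltnS (ltn_predK yk) yk/=.
exact: feasible_le.
Qed.

(* Giving agent n as many further divisions as possible saturates y, at no cost
   since her marginals are nonnegative. This is how a deviation that leaves some
   of the resource unallocated is compared with y'. *)
Lemma total_value_exchange (R : realType) (N : nat) (f : {set 'I_N} -> R)
    (M : nat) (beta delta : R) (V V' T : reports R N) (y y' : allocation N)
    (n : 'I_N) :
  normalized f -> monotone_setfun f -> submodular f ->
  f [set: 'I_N]%SET = 1 -> 0 < min_distance f -> 2 / min_distance f <= M%:R ->
  0 <= beta -> 0 <= delta ->
  optimal f M beta V y ->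
  (forall z, optimal f M beta V z -> (\sum_n z n <= \sum_n y n)%N) ->
  optimal f M beta V' y' ->
  (forall k, k != n -> V' k = V k) ->
  (forall k i j, k != n -> (i <= j < ftilde f M [set k]%SET)%N ->
     (V k)`_j <= (V k)`_i) ->
  (forall m, (m < ftilde f M [set n]%SET)%N -> 0 <= (T n)`_m) ->
  (forall k m, (m < ftilde f M [set k]%SET)%N ->
     (V' k)`_m <= (T k)`_m <= (V' k)`_m + delta) ->
  total_value T y <= total_value T y' + M%:R * delta.
Proof.
move=> f0 mono subf f1 d0 Md beta0 delta0 Vy ymax V'y' VV' Vmono Tpos TV'.
have yf := Vy.1; have y'f := V'y'.1.
have [t [zf sat]] := exists_saturation n yf; set z := add_units y n t in zf sat.
have subg A B := ftilde_submodular A B f0 mono subf d0 Md.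
have sum_le : (\sum_k y' k <= \sum_k z k)%N.
  apply: (saturated_sum_le (ftilde0 M f0) subg zf y'f) => k zk.
  (* Agent [n] is saturated by the choice of [t]. For another agent, a set tight for [y] stays tight
     for the larger feasible [z]. *)
  have [->|kn] := eqVneq k n; first exact: saturated_tight.
  have yk : z k = y k by rewrite ffunE (negbTE kn) addn0.
  rewrite yk in zk.
  have next := tie_not_extendable Vy ymax V'y' (VV' _ kn)
    (fun i j => Vmono k i j kn) zk.
  have [S kS tightS] := saturated_tight yf next.
  exists S => //; apply/eqP; rewrite eqn_leq zf/= -tightS.
  by rewrite sum_add_units leq_addr.
apply: (@le_trans _ _ (total_value T z)).
  apply: total_value_add_units => m my; apply: Tpos.
  apply: leq_trans my _; have := feasible_le n zf.
  by rewrite ffunE eqxx mul1n.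
(* Adding the [beta] term of [z] turns the left side into an objective, to which optimality of [y']
   under [V'] applies; [sum_le] then replaces the [beta] term of [y'] by that of [z]. *)
rewrite -(lerD2r (beta / M%:R * (\sum_k z k)%:R)) -objectiveE.
have /andP[_ up] := objective_perturbation beta mono f1 zf TV' delta0.
have /andP[lo _] := objective_perturbation beta mono f1 y'f TV' delta0.
apply: le_trans up _; rewrite addrAC lerD2r.
apply: le_trans (V'y'.2 _ zf) (le_trans lo _).
by rewrite objectiveE lerD2l ler_wpM2l ?divr_ge0// ler_nat.
Qed.

(** * Rounded reports: approximate dominance and the welfare bound *)

Lemma nth_scaled (R : realType) (N : nat) (delta : R)
    (W : {ffun 'I_N -> seq int}) (k : 'I_N) (m : nat) :
  (scaled delta W k)`_m = ((W k)`_m)%:~R * delta.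
Proof.
rewrite ffunE; have [lt|ge] := ltnP m (size (W k)).
  by rewrite (nth_map 0).
by rewrite !nth_default ?size_map// mul0r.
Qed.

Lemma nth_truthful (R : realType) (N : nat) (f : {set 'I_N} -> R) (M : nat)
    (beta : R) (u : 'I_N -> R -> R) (k : 'I_N) (m : nat) :
  (m < ftilde f M [set k]%SET)%N ->
  (truthful f M beta u k)`_m = true_marginal M beta u k m.
Proof. by move=> mk; rewrite ffunE nth_mkseq. Qed.

Lemma rounded_report_le (R : realType) (N : nat) (f : {set 'I_N} -> R)
    (M : nat) (beta delta : R) (u : 'I_N -> R -> R) (k : 'I_N) (m : nat) :
  0 < delta -> (m < ftilde f M [set k]%SET)%N ->
  ((rounded_report f M beta u delta k)`_m)%:~R * delta <=
    (truthful f M beta u k)`_m <=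
  ((rounded_report f M beta u delta k)`_m)%:~R * delta + delta.
Proof.
move=> d0 mk; rewrite nth_truthful// /rounded_report nth_mkseq//.
have /andP[lo up] := floor_itv (true_marginal M beta u k m / delta).
rewrite -ler_pdivlMr// lo/= -[X in _ + X]mul1r -mulrDl -ler_pdivrMr// ltW//.
by rewrite intrD in up.
Qed.

(** Concavity makes the true marginals non-increasing, and the floor preserves order. *)
Lemma rounded_report_strategy (R : realType) (N : nat) (f : {set 'I_N} -> R)
    (M : nat) (alpha beta delta : R) (u : 'I_N -> R -> R) (k : 'I_N) :
  0 < delta -> utility alpha beta (u k) ->
  strategy f M k (rounded_report f M beta u delta k).
Proof.
move=> d0 uk; split; first by rewrite size_mkseq.
rewrite /rounded_report /mkseq sorted_map.
apply: sub_sorted (iota_sorted 0 _) => i j ij /=.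
apply: le_floor; rewrite ler_pM2r ?invr_gt0//.
exact: true_marginal_noninc uk _ _ ij.
Qed.

Lemma strategy_noninc (R : realType) (N : nat) (f : {set 'I_N} -> R) (M : nat)
    (k : 'I_N) (w : seq int) (i j : nat) :
  strategy f M k w -> (i <= j < ftilde f M [set k]%SET)%N -> w`_j <= w`_i.
Proof.
move=> [sw w_sorted] /andP[ij jk].
have tr : transitive (>=%R : rel int) by move=> a b c ba cb; exact: le_trans ba.
apply: (sorted_leq_nth tr (@lexx _ _) 0 w_sorted) => //=.
  by rewrite inE sw (leq_ltn_trans ij).
by rewrite inE sw.
Qed.

Lemma divisions_gt1 (R : realType) (N : nat) (f : {set 'I_N} -> R) (M : nat)
    (alpha beta : R) (u : 'I_N -> R -> R) (tie : reports R N -> allocation N) :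
  environment f M alpha beta u tie -> (1 < M)%N.
Proof.
case=> f0 mono subf f1 d0 Md _ _ _ _.
have d1 := min_distance_le1 f0 mono subf f1 d0.
rewrite -(ler_nat R); apply: le_trans Md.
by rewrite ler_pdivlMr// ler_piMr.
Qed.

Lemma rounded_report_eps_dominant (R : realType) (N : nat)
    (f : {set 'I_N} -> R) (M : nat) (alpha beta : R) (u : 'I_N -> R -> R)
    (tie : reports R N -> allocation N) (delta : R) (n : 'I_N) :
  environment f M alpha beta u tie -> 0 < delta ->
  eps_dominant (strategy f M) (rounded_payoff f M beta tie u delta)
    (M%:R * delta) n (rounded_report f M beta u delta n).
Proof.
move=> env d0; have M0 := ltnW (divisions_gt1 env).
case: env => f0 mono subf f1 dist0 Md _ beta0 uu tiebreak.
split=> [|W stratW]; first exact: rounded_report_strategy (uu n).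
set w := rounded_report _ _ _ _ _ _.
set V := scaled delta W; set V' := scaled delta (replace_report W n w).
have [optV maxV] := tiebreak V; have [optV' _] := tiebreak V'.
rewrite /rounded_payoff (payoffE _ _ _ optV.1) (payoffE _ _ _ optV'.1) -/V -/V'.
(* Zeroing the report of [n] erases the deviation, so the two payoffs differ only in the total value
   under [T]: the truth for [n], the given reports for the others. *)
have -> : zero_report f M V' n = zero_report f M V n.
  by apply/ffunP => k; rewrite !ffunE; case: eqP => // kn; rewrite ffunE (negbTE kn).
set T := replace_report V n _.
have -> : replace_report V' n (truthful f M beta u n) = T.
  apply/ffunP => k; rewrite [LHS]ffunE [RHS]ffunE; case: eqVneq => // kn.
  by rewrite !ffunE (negbTE kn).
rewrite -[leRHS]addrA lerD2l.
have VV' k : k != n -> V' k = V k by move=> kn; rewrite !ffunE (negbTE kn).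
apply: (total_value_exchange f0 mono subf f1 dist0 Md (ltW beta0) (ltW d0)
  optV maxV optV' VV') => [k i j kn ijk|m mn|k m mk].
- rewrite !nth_scaled ler_pM2r// ler_int.
  exact: strategy_noninc (stratW k) ijk.
- rewrite ffunE eqxx nth_truthful// ltW//.
  exact: true_marginal_gt0 (uu n).
- rewrite [T k]ffunE; have [kn|kn] := eqVneq k n.
    rewrite kn in mk *; rewrite nth_scaled ffunE eqxx.
    exact: rounded_report_le.
  by rewrite VV'// lexx lerDl ltW.
Qed.

(** Pass from [T] to [V] at the truthful optimum, at a cost of at most [M%:R * delta], use
    optimality under [V], and return to [T] at the rounded optimum at no cost. Optimality under [T]
    gives the sign of the gap. *)
Lemma welfare_gap_le (R : realType) (N : nat) (f : {set 'I_N} -> R) (M : nat)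
    (alpha beta : R) (u : 'I_N -> R -> R) (tie : reports R N -> allocation N)
    (delta : R) :
  environment f M alpha beta u tie -> 0 < delta ->
  welfare_gap f M beta u tie delta <= M%:R * delta.
Proof.
case=> f0 mono subf f1 _ _ _ _ _ tiebreak d0.
rewrite /welfare_gap /quantized_welfare /rounded_welfare.
set T := truthful _ _ _ _; set V := scaled _ _.
have [[Tf Topt] _] := tiebreak T; have [[Vf Vopt] _] := tiebreak V.
rewrite (social_welfareE beta u Tf) (social_welfareE beta u Vf) -/T.
have VT k m : (m < ftilde f M [set k]%SET)%N ->
    (V k)`_m <= (T k)`_m <= (V k)`_m + delta.
  by move=> mk; rewrite nth_scaled ffunE rounded_report_le.
have /andP[_ up] := objective_perturbation beta mono f1 Tf VT (ltW d0).
have /andP[lo _] := objective_perturbation beta mono f1 Vf VT (ltW d0).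
have := Topt _ Vf; have := Vopt _ Tf => VTle TVle.
by rewrite ger0_norm; lra.
Qed.

(** * Sharpness of the welfare bound *)

(** Feasible allocations have entries at most [M], hence live in a finite type: maximize the
    objective, then the number of divisions among the maximizers. This supplies a tie-breaking rule
    for the example. *)
Lemma exists_optimal_max (R : realType) (N : nat) (f : {set 'I_N} -> R)
    (M : nat) (beta : R) (V : reports R N) :
  monotone_setfun f -> f [set: 'I_N]%SET = 1 ->
  exists y, optimal f M beta V y /\
    forall z, optimal f M beta V z -> (\sum_n z n <= \sum_n y n)%N.
Proof.
move=> mono f1.
pose alloc (x : {ffun 'I_N -> 'I_M.+1}) : allocation N := [ffun n => val (x n)].
have alloc_onto y : feasible f M y -> exists x, y = alloc x.
  move=> yf; exists [ffun n => inord (y n)]; apply/ffunP => n.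
  rewrite !ffunE /= inordK// ltnS; apply: leq_trans (feasible_le n yf) _.
  exact: ftilde_le.
pose P := [pred x | `[< feasible f M (alloc x) >]].
have P0 : P [ffun=> ord0].
  apply/asboolP => S; rewrite big1// => n _; by rewrite !ffunE.
case: (arg_maxP (fun x => objective M beta V (alloc x)) P0) => x /asboolP xf xmax.
pose Q := [pred x | `[< optimal f M beta V (alloc x) >]].
have Qx : Q x.
  apply/asboolP; split=> // z zf; have [x' zx'] := alloc_onto z zf.
  by rewrite zx'; apply: xmax; apply/asboolP; rewrite -zx'.
case: (arg_maxnP (fun x => \sum_n alloc x n)%N Qx) => y /asboolP yopt ymax.
exists (alloc y); split=> // z zopt; have [x' zx'] := alloc_onto z zopt.1.
by rewrite zx'; apply: ymax; apply/asboolP; rewrite -zx'.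
Qed.

Lemma linear_utility (R : realType) (alpha beta c : R) :
  0 < beta -> beta < c < alpha -> utility alpha beta (fun x => c * x).
Proof.
move=> beta0 /andP[bc ca]; have c0 : 0 < c := lt_trans beta0 bc.
have dc (x : R) : is_derive x 1 (fun x : R => c * x) c.
  by apply: is_derive_eq; rewrite /GRing.scale/= mulr1.
split=> [x x0|t x y _ _|x y _ _ xy||x x0].
- by rewrite mulr_ge0// ltW.
- pose a : R := t%:num; pose b : R := 1 - t%:num.
  suff : - (c * (a * x + b * y)) <= a * - (c * x) + b * - (c * y) by [].
  by lra.
- by rewrite ltr_pM2l.
- split=> [x _|]; first by have [] := dc x.
  by apply: cvg_at_right_filter; exact: mulrl_continuous.
- by rewrite derive1E; have [_ ->] := dc x; rewrite bc.
Qed.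

(** The rank function of the uniform matroid of rank one on two agents: only the total number of
    divisions is constrained, and every [M] from 2 on is admissible. *)
Definition nonempty_indicator (R : realType) (S : {set 'I_2}) : R :=
  (S != finset.set0)%:R.

Lemma min_distance_nonempty_indicator (R : realType) :
  min_distance (@nonempty_indicator R) = 1.
Proof.
rewrite -[RHS](inf1 1) /min_distance; congr inf; apply/seteqP.
have value (S : {set 'I_2}) (i j : 'I_2) : i \notin S -> j \notin S -> i != j ->
    `|nonempty_indicator R (i |: S) + nonempty_indicator R (j |: S) -
      nonempty_indicator R S - nonempty_indicator R (i |: (j |: S))| = 1.
  move=> iS jS ij.
  (* Two distinct agents outside [S] exhaust the two available ones. *)
  have S0 : S = finset.set0.
    apply/finset.setP => k; rewrite inE; apply/negP => kS.
    have ki : k != i by apply: contraNneq iS => <-.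
    have kj : k != j by apply: contraNneq jS => <-.
    have := card_ord 2; rewrite cardE; move: ij ki kj.
    by case: i {iS} => [[|[|]]//= ?]; case: j {jS} => [[|[|]]//= ?];
       case: k {kS} => [[|[|]]//= ?].
  have U1 k (A : {set 'I_2}) : (k |: A != finset.set0).
    by apply/set0Pn; exists k; exact: finset.setU11.
  by rewrite /nonempty_indicator !U1 S0 eqxx/= subr0 addrK normr1.
split=> [d [S [i [j [iS jS ij ->]]]]|d ->]; first exact: value.
exists finset.set0, ord0, ord_max; split; rewrite ?inE// value ?inE//.
Qed.

Lemma feasible_nonempty_indicator (R : realType) (M : nat) (y : allocation 2) :
  feasible (@nonempty_indicator R) M y <-> (\sum_n y n <= M)%N.
Proof.
have ft (S : {set 'I_2}) :
    S != finset.set0 -> ftilde (@nonempty_indicator R) M S = M.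
  by move=> S0; rewrite /ftilde /nonempty_indicator S0 mul1r natrK.
have sumT : (\sum_n y n = \sum_(n in [set: 'I_2]%SET) y n)%N.
  by apply: eq_bigl => n; rewrite inE.
split=> [/(_ [set: 'I_2]%SET)|yM S].
  by rewrite sumT ft//; apply/set0Pn; exists ord0; rewrite inE.
have [->|S0] := eqVneq S finset.set0; first by rewrite big_set0.
rewrite ft//; apply: leq_trans yM; rewrite [leqRHS](bigID (mem S))/=.
exact: leq_addr.
Qed.

(* Agent 0 values each division at almost 2 delta and agent 1 at delta above
   the common beta / M; both values round to delta, so the rounded mechanism may
   hand everything to agent 1. *)
Lemma welfare_gap_attained (R : realType) (M : nat) (eps s : R) :
  (1 < M)%N -> 0 < s < eps -> welfare_gaps M (eps / M%:R) (eps - s).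
Proof.
move=> M1 /andP[s0 seps]; have eps0 : 0 < eps := lt_trans s0 seps.
have M0 : 0 < M%:R :> R by rewrite ltr0n ltnW.
have Mn0 : M%:R != 0 :> R by rewrite gt_eqF.
set delta := eps / M%:R; have delta0 : 0 < delta by rewrite divr_gt0.
pose f := @nonempty_indicator R.
(* With [beta = 1], the true marginals are [(c n - 1) / M%:R], that is [2 * delta - s / M%:R] and
   [delta]. The bounds on [s] make the former round down to [delta] as well. *)
pose c (n : 'I_2) : R := if n == ord0 then 1 + 2 * eps - s else 1 + eps.
pose u n x := c n * x.
have f0 : normalized f by rewrite /normalized /f /nonempty_indicator eqxx.
have mono : monotone_setfun f.
  move=> S T ST; rewrite ler_nat; have [//|/set0Pn[k kS]] := eqVneq S finset.set0.
  suff -> : T != finset.set0 by [].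
  by apply/set0Pn; exists k; exact: (fintype.subsetP ST).
have f1 : f [set: 'I_2]%SET = 1.
  rewrite /f /nonempty_indicator (_ : _ != _)//.
  by apply/set0Pn; exists ord0; rewrite inE.
have subf : submodular f.
  move=> S T; rewrite -!natrD ler_nat finset.setU_eq0.
  case: (eqVneq S finset.set0) => [->|S0]; first by rewrite finset.set0I eqxx addn0.
  case: (eqVneq T finset.set0) => [->|T0]; first by rewrite finset.setI0 eqxx addn0.
  by rewrite /= leq_add2l leq_b1.
pose y1 : allocation 2 := [ffun n => if n == ord0 then 0 else M]%N.
pose y0 : allocation 2 := [ffun n => if n == ord0 then M else 0]%N.
have sum2 (F : 'I_2 -> nat) : (\sum_n F n = F ord0 + F ord_max)%N.
  by rewrite big_ord_recl big_ord1; congr (_ + F _)%N; exact: val_inj.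
have sum_y1 : (\sum_n y1 n = M)%N by rewrite sum2 !ffunE.
have y1f : feasible f M y1 by apply/feasible_nonempty_indicator; rewrite sum_y1.
have y0f : feasible f M y0.
  by apply/feasible_nonempty_indicator; rewrite sum2 !ffunE addn0.
have best V : {y | optimal f M 1 V y /\
    forall z, optimal f M 1 V z -> (\sum_n z n <= \sum_n y n)%N}.
  exact/cid/exists_optimal_max.
(* Ties are resolved for [y1] whenever it is optimal; it hands out all [M] divisions, so no optimal
   allocation hands out more. *)
pose tie V := if `[< optimal f M 1 V y1 >] then y1 else sval (best V).
have tiebreak : tie_breaking f M 1 tie.
  move=> V; rewrite /tie; case: ifPn => [/asboolP y1opt|_].
    split=> // z [/feasible_nonempty_indicator zM _]; by rewrite sum_y1.
  by case: (best V).
have uu n : utility (2 + 2 * eps) 1 (u n).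
  by apply: linear_utility => //; rewrite /c; case: ifP => _; lra.
have env : environment f M (2 + 2 * eps) 1 u tie.
  split=> //; rewrite ?min_distance_nonempty_indicator ?divr1 ?ler_nat//.
  by rewrite addr_gt0// mulr_gt0.
exists 2, f, (2 + 2 * eps), 1, u, tie; split=> //.
have SWE y : social_welfare M u y =
    c ord0 * ((y ord0)%:R / M%:R) + c ord_max * ((y ord_max)%:R / M%:R).
  rewrite /social_welfare big_ord_recl big_ord1.
  by have -> : lift ord0 ord0 = ord_max :> 'I_2 by exact: val_inj.
have y1opt : optimal f M 1
    (scaled delta [ffun n => rounded_report f M 1 u delta n]) y1.
  set V := scaled _ _.
  (* After rounding every division is worth [delta] to either agent, so only the number of divisions
     counts. *)
  have valueE z : feasible f M z -> total_value V z = delta * (\sum_n z n)%:R.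
    move=> zf; rewrite natr_sum mulr_sumr; apply: eq_bigr => n _.
    rewrite /reported_value (eq_big_nat _ _ (F2 := fun=> delta)).
      by rewrite sumr_const_nat subn0 mulr_natr.
    move=> m /andP[_ mz]; rewrite nth_scaled ffunE nth_mkseq; last first.
      exact: leq_trans mz (feasible_le n zf).
    suff -> : Num.floor (true_marginal M 1 u n m / delta) = 1 by rewrite mul1r.
    apply: floor_def; rewrite ler_pdivlMr// ltr_pdivrMr// mul1r.
    have -> : true_marginal M 1 u n m = (c n - 1) / M%:R.
      by rewrite /true_marginal /u -natr1; field.
    rewrite /delta mulrA ler_pM2r ?invr_gt0// ltr_pM2r ?invr_gt0//.
    by rewrite /c; case: ifP => _; lra.
  split=> // z zf; rewrite !objectiveE !valueE// -!mulrDl ler_wpM2l//.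
    by rewrite divr_ge0// addr_ge0// ltW.
  by move/feasible_nonempty_indicator: zf; rewrite ler_nat sum_y1.
have -> : welfare_gap f M 1 u tie delta = `|c ord0 - c ord_max|.
  congr (`|_ - _|).
    set T := truthful f M 1 u; have [[zf zopt] _] := tiebreak T.
    rewrite /quantized_welfare -/T; apply/eqP; rewrite eq_le; apply/andP; split.
      (* Upper bound: moving all divisions to the agent with the larger slope loses nothing, and the
         shares sum to at most 1. *)
      have := zf; rewrite SWE => /feasible_nonempty_indicator.
      rewrite sum2 -(ler_nat R) natrD.
      set a := (tie T ord0)%:R; set b := (tie T ord_max)%:R => abM.
      have b0 : 0 <= b / M%:R by rewrite divr_ge0.
      have /(ler_wpM2r b0) : c ord_max <= c ord0 by rewrite /c/=; lra.
      move/(lerD (lexx (c ord0 * (a / M%:R)))) => /le_trans; apply.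
      rewrite -mulrDr -mulrDl ler_piMr//; first by rewrite /c/=; lra.
      by rewrite ler_pdivrMr// mul1r.
    (* Lower bound: compare with giving everything to agent [ord0]. *)
    have := zopt y0 y0f; rewrite -(lerD2l (\sum_n u n 0)).
    rewrite -!social_welfareE// [leLHS]SWE !ffunE/=.
    by rewrite mul0r mulr0 addr0 divff ?mulr1.
  rewrite /rounded_welfare /tie; rewrite ifT; last exact/asboolP.
  by rewrite SWE !ffunE/= mul0r mulr0 add0r divff ?mulr1.
by rewrite /c/= ger0_norm; lra.
Qed.

(** The gaps [eps - s] with [s] arbitrarily small approach the upper bound. *)
Lemma sup_welfare_gaps (R : realType) (M : nat) (eps : R) :
  (1 < M)%N -> 0 < eps -> sup (welfare_gaps M (eps / M%:R)) = eps.
Proof.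
move=> M1 eps0; have M0 : 0 < M%:R :> R by rewrite ltr0n ltnW.
have ub : ubound (welfare_gaps M (eps / M%:R)) eps.
  move=> _ [N [f [alpha [beta [u [tie [env ->]]]]]]].
  have := welfare_gap_le env (divr_gt0 eps0 M0).
  by rewrite [M%:R * _]mulrC divfK ?gt_eqF.
apply/eqP; rewrite eq_le; apply/andP; split.
  apply: ge_sup => //; exists (eps - eps / 2).
  (* Any admissible [s] shows that the set of gaps is nonempty; here [s = eps / 2]. *)
  by apply: welfare_gap_attained => //; lra.
(* The minimum keeps [s] strictly below [eps] even when [e] is large. *)
apply/ler_addgt0Pr => e e0; pose s := Num.min e (eps / 2).
have se : s <= e by rewrite ge_min lexx.
have s_bounds : 0 < s < eps.
  rewrite lt_min e0 divr_gt0//=; apply: (@le_lt_trans _ _ (eps / 2)).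
    by rewrite ge_min lexx orbT.
  by lra.
have := ub_le_sup (ex_intro _ eps ub) (welfare_gap_attained M1 s_bounds).
by lra.
Qed.

Unset Implicit Arguments.
Set Strict Implicit.

Theorem theorem4p3 (R : realType) (N : nat) (f : {set 'I_N} -> R) (M : nat)
    (alpha beta : R) (u : 'I_N -> R -> R) (tie : reports R N -> allocation N)
    (eps delta : R)
    (henv : environment f M alpha beta u tie)
    (heps : 0 < eps) (hdelta : delta = eps / M%:R) :
  (forall n : 'I_N,
     eps_dominant (strategy f M) (rounded_payoff f M beta tie u delta) eps n
       (rounded_report f M beta u delta n)) /\
  [/\ welfare_gap f M beta u tie delta <= eps,
      sup (welfare_gaps M delta) = eps
    & eps = M%:R * delta].
Proof.
have M1 := divisions_gt1 henv.
have M0 : 0 < M%:R :> R by rewrite ltr0n ltnW.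
have epsE : eps = M%:R * delta by rewrite hdelta mulrC divfK ?gt_eqF.
have delta0 : 0 < delta by rewrite hdelta divr_gt0.
split=> [n|]; first by rewrite {1}epsE; exact: rounded_report_eps_dominant henv _.
split=> //; first by rewrite epsE; exact: welfare_gap_le henv _.
by rewrite hdelta; exact: sup_welfare_gaps.
Qed.
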